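(* Let $\Phi$ be a Følner sequence on $\mathbb{N}$ and let $h\in\mathsf{Bes}(\mathbb{N},\Phi)$ be bounded. Then there is a subsequence $\Psi$ of $\Phi$ such that $\|\mathsf{R}^{\mathfrak{p}}h\|_\Psi=\|h\|_\Psi$ for $\Psi$-almost every ultrafilter $\mathfrak{p}$ on $\mathbb{N}$.
   Context: A Følner sequence in $\mathbb{N}$ is a sequence $\Phi\colon N\mapsto\Phi_N$ of finite non-empty subsets of $\mathbb{N}$ with $|(\Phi_N+m)\triangle\Phi_N|/|\Phi_N|\to0$ for all $m\in\mathbb{N}$. $\|f\|_\Phi=\big(\limsup_{N\to\infty}\frac{1}{|\Phi_N|}\sum_{n\in\Phi_N}|f(n)|^2\big)^{1/2}$. A trigonometric polynomial is $n\mapsto\sum_{j=1}^Jc_je^{2\pi i\theta_jn}$ ($c_j\in\mathbb{C}$, $\theta_j\in[0,1)$); $\mathsf{Bes}(\mathbb{N},\Phi)$ is the set of functions approximable arbitrarily well in $\|\cdot\|_\Phi$ by trigonometric polynomials. For an ultrafilter $\mathfrak{p}$ and bounded $h$, $(\mathsf{R}^{\mathfrak{p}}h)(n)=\lim_{m\to\mathfrak{p}}h(n+m)$. $\beta\mathbb{N}$ denotes the space of ultrafilters on $\mathbb{N}$ (Stone–Čech compactification), and $\mathcal{M}(\Psi)$ is the set of Radon probability measures on $\beta\mathbb{N}$ that are weak$^*$ accumulation points of $\{\frac{1}{|\Psi_N|}\sum_{n\in\Psi_N}\delta_n\}$, $\delta_n$ the point mass at the principal ultrafilter of $n$. A property holds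 for $\Psi$-almost every ultrafilter if the set of ultrafilters with the property has full measure for every $\mu\in\mathcal{M}(\Psi)$. *)

(* Defs.v *)
From HB Require Import structures.
From mathcomp Require Import all_boot all_order all_algebra finmap.
From mathcomp Require Import all_classical all_reals all_analysis.
From mathcomp Require Import complex.
Set Implicit Arguments. Unset Strict Implicit. Unset Printing Implicit Defensive.
Import Order.TTheory GRing.Theory Num.Theory.
Import numFieldNormedType.Exports.
Local Open Scope classical_set_scope.
Local Open Scope ring_scope.

Record betaN := BetaN { uf : set_system nat ; uf_ultra : UltraFilter uf }.
HB.instance Definition _ := gen_eqMixin betaN.
HB.instance Definition _ := gen_choiceMixin betaN.

Definition principal (n : nat) : betaN :=
  BetaN (principal_filter_ultra n).
HB.instance Definition _ := isPointed.Build betaN (principal 0).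

Definition betaN_base (A : set nat) : set betaN := [set p | uf p A].

Lemma betaN_cover : \bigcup_(A in [set: set nat]) betaN_base A = setT.
Proof.
apply/seteqP; split => // p _; exists setT => //.
rewrite /betaN_base /=; case: p => F FF /=; exact: filterT.
Qed.

Lemma betaN_join (A B : set nat) (p : betaN) :
  [set: set nat] A -> [set: set nat] B -> betaN_base A p -> betaN_base B p ->
  exists C, [/\ [set: set nat] C, betaN_base C p &
               betaN_base C `<=` betaN_base A `&` betaN_base B].
Proof.
move=> _ _ pA pB; exists (A `&` B); split => //.
  by rewrite /betaN_base /=; move: pA pB; case: p => F FF /= ??; exact: filterI.
move=> q; rewrite /betaN_base /=; case: q => F FF /= FAB; split;
  by apply: filterS FAB => x [].
Qed.

HB.instance Definition _ :=
  isBaseTopological.Build betaN betaN_cover betaN_join.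


Definition betaB := g_sigma_algebraType (@open betaN).

(** Radon probability measures on beta N: Borel probability measures which are
    inner regular by compact sets (on a compact Hausdorff space, local
    finiteness is automatic for a probability measure). *)
Definition radon (R : realType) (mu : probability betaB R) : Prop :=
  forall A : set betaB, measurable A -> forall e : R, 0 < e ->
    exists K : set betaN,
      [/\ compact K, (K : set betaB) `<=` A & (mu A <= mu K + e%:E)%E].

Definition avg (R : realType) (Psi : nat -> {fset nat}) (f : nat -> R) (N : nat)
  : R := (\sum_(n <- Psi N) f n) / (#|` Psi N|)%fset%:R.

(** mu is a weak-* accumulation point of the sequence of measures
    (1/|Psi_N|) sum_{n in Psi_N} delta_n : every basic weak-* neighbourhood of
    mu (given by finitely many continuous functions and eps) contains terms of
    arbitrarily large index.  The integral of f against the averaged point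
    masses is written out as the average of f over the principal ultrafilters. *)
Definition weak_acc (R : realType) (Psi : nat -> {fset nat})
  (mu : probability betaB R) : Prop :=
  forall (k : nat) (fs : nat -> betaN -> R),
    (forall i, (i < k)%N -> continuous (fs i)) ->
    forall e : R, 0 < e -> forall N0 : nat,
      exists2 N : nat, (N0 <= N)%N &
        forall i, (i < k)%N ->
          (`| \int[mu]_x (fs i x)%:E
              - (avg Psi (fun n => fs i (principal n)) N)%:E | < e%:E)%E.

Definition accM (R : realType) (Psi : nat -> {fset nat})
  (mu : probability betaB R) : Prop := radon mu /\ weak_acc Psi mu.

Definition shift_fset (A : {fset nat}) (m : nat) : {fset nat} :=
  [fset (n + m)%N | n in A]%fset.

Definition symdiff_fset (A B : {fset nat}) : {fset nat} :=
  fsetU (fsetD A B) (fsetD B A).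

Definition folner (R : realType) (Phi : nat -> {fset nat}) : Prop :=
  (forall N, Phi N != fset0) /\
  forall m : nat,
    (fun N => ((#|` symdiff_fset (shift_fset (Phi N) m) (Phi N)|)%fset%:R
               / (#|` Phi N|)%fset%:R : R)) @ \oo --> (0 : R).

Local Open Scope complex_scope.

Definition besnorm (R : realType) (Psi : nat -> {fset nat}) (f : nat -> R[i])
  : \bar R :=
  match limn_esup (fun N => (avg Psi (fun n => ComplexField.Normc.normc (f n) ^+ 2) N)%:E) with
  | EFin r => (Num.sqrt r)%:E
  | EPInf => +oo%E
  | ENInf => -oo%E
  end.

Definition e2pi (R : realType) (x : R) : R[i] :=
  (cos (2 * pi * x)) +i* (sin (2 * pi * x)).

Definition trig_poly (R : realType) (P : nat -> R[i]) : Prop :=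
  exists (J : nat) (c : nat -> R[i]) (theta : nat -> R),
    (forall j, (j < J)%N -> 0 <= theta j < 1) /\
    forall n, P n = \sum_(j < J) c j * e2pi (theta j * n%:R).

Definition besicovitch (R : realType) (Phi : nat -> {fset nat})
  (h : nat -> R[i]) : Prop :=
  forall e : R, 0 < e -> exists P : nat -> R[i],
    trig_poly P /\ (besnorm Phi (fun n => (h n - P n)%R) < e%:E)%E.

Definition bounded_cseq (R : realType) (h : nat -> R[i]) : Prop :=
  exists M : R, forall n, ComplexField.Normc.normc (h n) <= M.

Definition ulim_to (R : realType) (p : betaN) (u : nat -> R[i]) (z : R[i])
  : Prop :=
  forall e : R, 0 < e -> uf p [set m | ComplexField.Normc.normc (u m - z) < e].

Definition Rp (R : realType) (p : betaN) (h : nat -> R[i]) : nat -> R[i] :=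
  fun n => xget 0 [set z | ulim_to p (fun m => h (n + m)%N) z].

(* Main.v *)
(** Put g = |h|^2. Approximating h by trigonometric polynomials P makes |P|^2
    approximate g in Phi-mean, and the Phi_N-averages of |P|^2(. + m) vary little
    with m. Hence the function D_N(m) = |avg_{n in Phi_N} (g(n + m) - g(n))| has
    small Phi_K-mean once N, and then K, are large. Choose sigma so sparse that
    D_{sigma k} has Phi_K-mean at most 2^-(k+1) for all large K. For mu in M(Psi)
    the continuous extension F_k of D_{sigma k} to beta N then has mu-integral at
    most 2^-k, so sum_k F_k is finite and F_k(p) -> 0 for mu-almost every p.
    Since F_k(p) is the distance between the Psi_k-averages of |R^p h|^2 and
    |h|^2, the two limsups agree. No ergodic theorem is needed, which is what makes
    sigma independent of mu. *)
Require Import Defs.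
From HB Require Import structures.
From mathcomp Require Import all_boot all_order all_algebra finmap.
From mathcomp Require Import all_classical all_reals all_analysis.
From mathcomp Require Import complex.
From mathcomp Require Import measurable_realfun ring lra.
Import Order.TTheory GRing.Theory Num.Theory.
Import numFieldNormedType.Exports.
Local Open Scope classical_set_scope.
Local Open Scope ring_scope.

(** * Means over finite sets and their behaviour under shifts *)

(** [avg Psi f N] unfolds to [mean (Psi N) f]; taking the set itself as argument lets means over two
    sets be nested and exchanged. *)
Definition mean (R : realType) (A : {fset nat}) (f : nat -> R) : R :=
  (\sum_(n <- A) f n) / (#|` A|)%fset%:R.
Arguments mean {R}.

Definition boundary_ratio (R : realType) (A : {fset nat}) (m : nat) : R :=
  (#|` symdiff_fset (shift_fset A m) A|)%fset%:R / (#|` A|)%fset%:R.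

Section Mean.
Context {R : realType}.
Implicit Types (A B : {fset nat}) (f g : nat -> R).

Lemma mean_linear A (c : R) f g :
  mean A (fun n => c * f n + g n) = c * mean A f + mean A g.
Proof. by rewrite /mean big_split/= -mulr_sumr mulrDl mulrA. Qed.

Lemma meanB A f g : mean A (fun n => f n - g n) = mean A f - mean A g.
Proof. by rewrite /mean sumrB mulrBl. Qed.

Lemma ler_mean A f g : (forall n, f n <= g n) -> mean A f <= mean A g.
Proof. by move=> fg; rewrite ler_wpM2r ?invr_ge0// ler_sum. Qed.

Lemma ler_norm_mean A f : `|mean A f| <= mean A (fun n => `|f n|).
Proof.
rewrite normrM [X in _ * X]ger0_norm ?invr_ge0//.
by rewrite ler_wpM2r ?invr_ge0// ler_norm_sum.
Qed.

Lemma mean_cst A (c : R) : A != fset0 -> mean A (fun=> c) = c.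
Proof.
move=> A0; rewrite /mean big_const_seq count_predT -Monoid.iteropE /=.
rewrite -/(GRing.natmul c _) -[c *+ _]mulr_natr mulfK// pnatr_eq0.
by rewrite -lt0n cardfs_gt0.
Qed.

Lemma norm_mean_le A f (D : R) : A != fset0 -> (forall n, `|f n| <= D) ->
  `|mean A f| <= D.
Proof.
move=> A0 fD; apply: le_trans (ler_norm_mean _ _) _.
by rewrite -[leRHS](mean_cst A)// ler_mean.
Qed.

Lemma exchange_mean A B (f : nat -> nat -> R) :
  mean A (fun m => mean B (f m)) = mean B (fun n => mean A (f ^~ n)).
Proof.
by rewrite /mean -!mulr_suml exchange_big/= mulrAC.
Qed.

Lemma sum_shift_fset A m f :
  \sum_(n <- shift_fset A m) f n = \sum_(n <- A) f (n + m)%N.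
Proof.
by rewrite /shift_fset big_imfset//= => x y _ _ /addIn.
Qed.

(** The terms over the intersection cancel, and what remains is indexed by the symmetric
    difference. *)
Lemma norm_sumB_fset A B f (D : R) : (forall n, `|f n| <= D) ->
  `|\sum_(n <- A) f n - \sum_(n <- B) f n| <= D * (#|` symdiff_fset A B|)%fset%:R.
Proof.
move=> fD.
have bd (C : {fset nat}) : `|\sum_(n <- C) f n| <= D * (#|` C|)%fset%:R.
  apply: le_trans (ler_norm_sum _ _ _) _.
  apply: le_trans (ler_sum _ (fun n _ => fD n)) _.
  by rewrite big_const_seq count_predT -Monoid.iteropE mulr_natr.
have split_inter (X Y : {fset nat}) : \sum_(n <- X) f n =
    \sum_(n <- (X `&` Y)%fset) f n + \sum_(n <- (X `\` Y)%fset) f n.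
  rewrite (big_fsetID _ (mem Y)); congr (_ + _); apply: eq_fbigl => i;
    by rewrite !inE// andbC.
rewrite (split_inter A B) (split_inter B A) [(B `&` A)%fset]fsetIC opprD
  addrACA subrr add0r.
rewrite /symdiff_fset cardfsU.
(* The two differences are disjoint, so their cardinals add up without correction. *)
have -> : ((A `\` B) `&` (B `\` A) = fset0)%fset.
  by apply/fsetP => i; rewrite !inE; case: (i \in A); case: (i \in B).
rewrite cardfs0 subn0 natrD mulrDr.
by apply: le_trans (ler_normB _ _) _; rewrite lerD.
Qed.

(** Reindexing trades the shift of the function for a shift of the set, which costs only boundary
    terms. *)
Lemma mean_shift A f (D : R) m : (forall n, `|f n| <= D) ->
  `|mean A (fun n => f (n + m)%N) - mean A f| <= D * boundary_ratio R A m.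
Proof.
move=> fD; rewrite /mean /boundary_ratio -mulrBl normrM mulrA.
rewrite [X in _ * X]ger0_norm ?invr_ge0// ler_wpM2r ?invr_ge0//.
by rewrite -sum_shift_fset norm_sumB_fset.
Qed.

End Mean.

(* Real trigonometric polynomials: a phase shift turns sines into cosines, so
   cosines alone span them. *)
Inductive trigfun (R : realType) : (nat -> R) -> Prop :=
| trigfun_cos (a b : R) : trigfun R (fun n => cos (a * n%:R + b))
| trigfun_linear (c : R) f g :
    trigfun R f -> trigfun R g -> trigfun R (fun n => c * f n + g n).

(** * Algebra and Følner means of real trigonometric polynomials *)

Section Trigfun.
Context {R : realType}.
Implicit Types f g : nat -> R.

Lemma trigfun0 : trigfun R (fun=> 0).
Proof.
have := @trigfun_linear R (-1) _ _ (trigfun_cos R 0 0) (trigfun_cos R 0 0).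
by congr trigfun; apply/funext => n; rewrite mulN1r addNr.
Qed.

Lemma trigfunZ (c : R) f : trigfun R f -> trigfun R (fun n => c * f n).
Proof.
move=> /(trigfun_linear R c) /(_ trigfun0).
by congr trigfun; apply/funext => n; rewrite addr0.
Qed.

Lemma trigfunD f g : trigfun R f -> trigfun R g -> trigfun R (fun n => f n + g n).
Proof.
move=> tf /(trigfun_linear R 1 f g tf).
by congr trigfun; apply/funext => n; rewrite mul1r.
Qed.

Lemma trigfun_sum (I : Type) (r : seq I) (F : I -> nat -> R) :
  (forall i, trigfun R (F i)) -> trigfun R (fun n => \sum_(i <- r) F i n).
Proof.
move=> tF; elim: r => [|i r IH].
  by under eq_fun do rewrite big_nil; exact: trigfun0.
by under eq_fun do rewrite big_cons; apply: trigfunD.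
Qed.

(** Induction on both factors reduces to two cosines, where the product-to-sum formula applies. *)
Lemma trigfunM f g : trigfun R f -> trigfun R g -> trigfun R (fun n => f n * g n).
Proof.
move=> tf; elim: tf g => [a b|c f1 f2 _ IH1 _ IH2] g tg.
  elim: tg => [a' b'|c g1 g2 _ IH1 _ IH2].
    have := trigfunZ 2^-1 _ (trigfunD _ _ (trigfun_cos R (a + a') (b + b'))
      (trigfun_cos R (a - a') (b - b'))).
    congr trigfun; apply/funext => n.
    have -> : (a + a') * n%:R + (b + b') = (a * n%:R + b) + (a' * n%:R + b') by ring.
    have -> : (a - a') * n%:R + (b - b') = (a * n%:R + b) - (a' * n%:R + b') by ring.
    by rewrite cosD cosB; field.
  have := trigfun_linear R c _ _ IH1 IH2.
  by congr trigfun; apply/funext => n; ring.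
have := trigfun_linear R c _ _ (IH1 _ tg) (IH2 _ tg).
by congr trigfun; apply/funext => n; ring.
Qed.

Lemma trigfun_bounded f : trigfun R f -> exists D, forall n, `|f n| <= D.
Proof.
elim=> [a b|c f1 f2 _ [D1 fD1] _ [D2 fD2]].
  by exists 1 => n; rewrite ler_norml cos_geN1 cos_le1.
exists (`|c| * D1 + D2) => n; apply: le_trans (ler_normD _ _) _.
by rewrite normrM lerD// ler_wpM2l.
Qed.

(* Telescoping: [2 sin (a/2) cos x = sin (x + a/2) - sin (x - a/2)]. *)
Lemma norm_mean_cos_le (A : {fset nat}) (a b : R) : sin (a / 2) != 0 ->
  `|mean A (fun n => cos (a * n%:R + b))| <=
    `|2 * sin (a / 2)|^-1 * boundary_ratio R A 1.
Proof.
move=> s0; pose G (n : nat) : R := sin (a * n%:R + b - a / 2).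
have GE n : cos (a * n%:R + b) = (2 * sin (a / 2))^-1 * (G (n + 1)%N - G n).
  rewrite /G natrD.
  have -> : a * (n%:R + 1%:R) + b - a / 2 = (a * n%:R + b) + a / 2 by field.
  by rewrite sinD sinB; field.
under eq_fun do rewrite GE.
have -> : mean A (fun n => (2 * sin (a / 2))^-1 * (G (n + 1)%N - G n)) =
    (2 * sin (a / 2))^-1 * (mean A (fun n => G (n + 1)%N) - mean A G).
  by rewrite -meanB /mean -mulr_sumr mulrA.
rewrite normrM normfV ler_wpM2l ?invr_ge0// -[leRHS]mul1r mean_shift// => n.
by rewrite ler_norml sin_geN1 sin_le1.
Qed.

(** This is the resonant case, where telescoping would divide by zero: a is a multiple of 2 pi.
    Splitting a into two halves, only the square of cos (a/2) occurs, so its sign does not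
    matter. *)
Lemma cos_period (a b : R) n m : sin (a / 2) = 0 ->
  cos (a * (n + m)%N%:R + b) = cos (a * n%:R + b).
Proof.
move=> s0; elim: m => [|m IH]; first by rewrite addn0.
rewrite addnS -natr1 -{}IH.
have -> : a * ((n + m)%:R + 1) + b = (a * (n + m)%:R + b) + (a / 2 + a / 2) by field.
have c1 : cos (a / 2) * cos (a / 2) = 1.
  by rewrite -expr2 cos2sin2 s0 expr0n subr0.
by rewrite cosD [cos (a / 2 + _)]cosD [sin (a / 2 + _)]sinD s0 c1
  !(mul0r, mulr0, addr0, subr0, mulr1).
Qed.

(* The threshold on [N] is uniform in the shift [m]. *)
Lemma trigfun_mean_shift (Phi : nat -> {fset nat}) f (e : R) :
  folner R Phi -> trigfun R f -> 0 < e ->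
  \forall N \near \oo, forall m,
    `|mean (Phi N) (fun n => f (n + m)%N) - mean (Phi N) f| <= e.
Proof.
move=> [Phi0 PhiF] tf; elim: tf e => [a b|c f1 f2 _ IH1 _ IH2] e e0.
  have [s0|s0] := eqVneq (sin (a / 2)) 0.
    near=> N => m; under eq_fun do rewrite cos_period//.
    by rewrite subrr normr0 ltW.
  have k0 : 0 < `|2 * sin (a / 2)| by rewrite normr_gt0 mulf_neq0.
  (* This tolerance cancels the factor in [norm_mean_cos_le] and leaves e / 2 for each of the two
     means. *)
  have /cvgrPdist_lt/(_ (e / 2 * `|2 * sin (a / 2)|)) := PhiF 1%N.
  rewrite mulr_gt0// ?divr_gt0// => /(_ isT); apply: filterS => N.
  rewrite sub0r normrN => /ltW bN m.
  (* The bound is the same for every phase, and a shift by m only alters the phase: hence the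
     uniformity in m. *)
  have cosN b' : `|mean (Phi N) (fun n => cos (a * n%:R + b'))| <= e / 2.
    apply: le_trans (norm_mean_cos_le _ _ _ s0) _.
    by rewrite mulrC ler_pdivrMr//; apply: le_trans bN; exact: ler_norm.
  have -> : (fun n => cos (a * (n + m)%N%:R + b)) =
            (fun n => cos (a * n%:R + (a * m%:R + b))).
    by apply/funext => n; rewrite natrD mulrDr addrA.
  by rewrite (splitr e); apply: le_trans (ler_normB _ _) _; rewrite lerD.
(* Adding 1 keeps the divisor positive when c = 0. *)
have c0 : 0 < `|c| + 1 by rewrite ltr_wpDl.
have e1 : 0 < e / 2 / (`|c| + 1) by rewrite !divr_gt0.
have e2 : 0 < e / 2 by rewrite divr_gt0.
near=> N => m.
rewrite !mean_linear.
have -> (x y z t : R) : c * x + y - (c * z + t) = c * (x - z) + (y - t) by ring.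
rewrite (splitr e); apply: le_trans (ler_normD _ _) _; rewrite lerD//; last first.
  by move: m; near: N; exact: IH2.
have h1 : `|mean (Phi N) (fun n => f1 (n + m)%N) - mean (Phi N) f1|
    <= e / 2 / (`|c| + 1).
  by move: m; near: N; exact: IH1.
rewrite normrM; apply: (@le_trans _ _ ((`|c| + 1) * (e / 2 / (`|c| + 1)))).
  by rewrite ler_pM// lerDl.
by rewrite mulrC divfK// gt_eqF.
Unshelve. all: by end_near. Qed.

End Trigfun.

(** * From approximation of h in the seminorm to approximation of its squared modulus in mean *)

Lemma sqr_normcE (R : realType) (z : R[i]) :
  ComplexField.Normc.normc z ^+ 2 = complex.Re z ^+ 2 + complex.Im z ^+ 2.
Proof. by case: z => a b /=; rewrite sqr_sqrtr// addr_ge0 ?sqr_ge0. Qed.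

Lemma trigfun_sin (R : realType) (a b : R) :
  trigfun R (fun n => sin (a * n%:R + b)).
Proof.
have := trigfun_cos R a (b - pi / 2); congr trigfun; apply/funext => n.
by rewrite addrA cosB cos_pihalf sin_pihalf mulr0 add0r mulr1.
Qed.

(** The real and imaginary parts are real trigonometric polynomials, and these are closed under
    squares and sums. *)
Lemma trig_poly_sqr_normc (R : realType) (P : nat -> R[i]) :
  trig_poly P -> trigfun R (fun n => ComplexField.Normc.normc (P n) ^+ 2).
Proof.
move=> [J [c [th [_ PE]]]].
have e2piE j n : e2pi (th j * n%:R) = (cos (2 * pi * th j * n%:R + 0) +i*
    sin (2 * pi * th j * n%:R + 0))%C.
  by rewrite /e2pi addr0 !mulrA.
have tRe : trigfun R (fun n => complex.Re (P n)).
  have -> : (fun n => complex.Re (P n)) = (fun n => \sum_(j < J)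
     (complex.Re (c j) * cos (2 * pi * th j * n%:R + 0) +
      - complex.Im (c j) * sin (2 * pi * th j * n%:R + 0))).
    apply/funext => n; rewrite PE raddf_sum/=; apply: eq_bigr => j _.
    by rewrite e2piE; case: (c j) => x y /=; rewrite mulNr.
  by apply: trigfun_sum => j; apply: trigfunD; apply: trigfunZ;
    [exact: trigfun_cos | exact: trigfun_sin].
have tIm : trigfun R (fun n => complex.Im (P n)).
  have -> : (fun n => complex.Im (P n)) = (fun n => \sum_(j < J)
     (complex.Re (c j) * sin (2 * pi * th j * n%:R + 0) +
      complex.Im (c j) * cos (2 * pi * th j * n%:R + 0))).
    apply/funext => n; rewrite PE raddf_sum/=; apply: eq_bigr => j _.
    by rewrite e2piE; case: (c j) => x y /=.
  by apply: trigfun_sum => j; apply: trigfunD; apply: trigfunZ;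
    [exact: trigfun_sin | exact: trigfun_cos].
under eq_fun do rewrite sqr_normcE.
by apply: trigfunD; under eq_fun do rewrite expr2; apply: trigfunM.
Qed.

Lemma besnorm_lt (R : realType) (Phi : nat -> {fset nat}) (f : nat -> R[i])
    (e : R) : 0 < e -> (besnorm Phi f < e%:E)%E ->
  \forall N \near \oo,
    mean (Phi N) (fun n => ComplexField.Normc.normc (f n) ^+ 2) <= e ^+ 2.
Proof.
move=> e0 nf.
have : (limn_esup (fun N => (avg Phi
    (fun n => ComplexField.Normc.normc (f n) ^+ 2) N)%:E) < (e ^+ 2)%:E)%E.
  move: nf; rewrite /besnorm; case: limn_esup => [r| |]//.
  (* [Num.sqrt] vanishes on negative reals, so a negative r must be compared with e ^+ 2
     directly. *)
  - rewrite !lte_fin => re; have [r0|r0] := leP 0 r.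
      by rewrite -(sqr_sqrtr r0) ltr_pXn2r// nnegrE ?sqrtr_ge0// ltW.
    by rewrite (lt_trans r0)// exprn_gt0.
  - by move=> _; rewrite ltNyr.
rewrite /limn_esup /limf_esup => /ereal_inf_lt[_ [A Aoo <-]] sA.
apply: filterS Aoo => N AN; rewrite -lee_fin; apply: le_trans (ltW sA).
by apply: ereal_sup_ubound; exists N.
Qed.

Lemma norm_normcB (R : realType) (x y : R[i]) :
  `|ComplexField.Normc.normc x - ComplexField.Normc.normc y|
    <= ComplexField.Normc.normc (x - y).
Proof. exact: (@ler_dist_dist _ (Rcomplex R)). Qed.

Lemma normc_ge0 (R : realType) (x : R[i]) : 0 <= ComplexField.Normc.normc x.
Proof. exact: (@normr_ge0 _ (Rcomplex R)). Qed.

(** The seminorm controls the mean of the squared distance only, so the linear term is absorbed into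
    e plus a quadratic term. The constant depends on the bound for x alone, hence can be fixed
    before the polynomial that supplies y. *)
Lemma norm_sqr_normcB_le (R : realType) (x y : R[i]) (M e : R) :
  0 < e -> ComplexField.Normc.normc x <= M ->
  `|ComplexField.Normc.normc x ^+ 2 - ComplexField.Normc.normc y ^+ 2|
    <= e + (M ^+ 2 / e + 1) * ComplexField.Normc.normc (x - y) ^+ 2.
Proof.
move=> e0; have := norm_normcB R x y; move: (normc_ge0 R x) (normc_ge0 R y).
set a := ComplexField.Normc.normc x; set b := ComplexField.Normc.normc y.
set t := ComplexField.Normc.normc (x - y) => a0 b0 abt aM.
have t0 : 0 <= t by apply: le_trans abt.
(* Factor the difference of squares as (a - b)(a + b) and use b <= a + t <= M + t. *)
apply: (@le_trans _ _ (t * (2 * M + t))).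
  rewrite subr_sqr normrM ler_pM// (ger0_norm (addr_ge0 a0 b0)).
  by move: abt; rewrite ler_norml => /andP[]; lra.
(* AM-GM: [2 M t <= e + (M t)^2 / e] *)
have : 0 <= (e - M * t) ^+ 2 / e by rewrite divr_ge0 ?sqr_ge0 ?ltW.
have -> : (e - M * t) ^+ 2 / e = e - 2 * M * t + M ^+ 2 / e * t ^+ 2.
  by field; rewrite gt_eqF.
lra.
Qed.

Lemma besicovitch_sqr_normc (R : realType) (Phi : nat -> {fset nat})
    (h : nat -> R[i]) (e : R) :
  folner R Phi -> besicovitch Phi h -> bounded_cseq h -> 0 < e ->
  exists2 Q, trigfun R Q & \forall N \near \oo,
    mean (Phi N) (fun n => `|ComplexField.Normc.normc (h n) ^+ 2 - Q n|) <= e.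
Proof.
move=> [Phi0 _] hB [M hM] e0.
have e20 : 0 < e / 2 by rewrite divr_gt0.
pose C : R := M ^+ 2 / (e / 2) + 1.
have C0 : 0 < C by rewrite ltr_wpDl// divr_ge0 ?sqr_ge0 ?ltW.
(* With this accuracy, C times the mean squared error is at most e / 2. *)
have d0 : 0 < Num.sqrt (e / 2 / C) by rewrite sqrtr_gt0 divr_gt0.
have [P [tP nP]] := hB _ d0.
exists (fun n => ComplexField.Normc.normc (P n) ^+ 2).
  exact: trig_poly_sqr_normc.
have := besnorm_lt _ _ _ _ d0 nP; apply: filterS => N.
rewrite sqr_sqrtr ?(divr_ge0 (ltW e20) (ltW C0))// => hN.
apply: le_trans (ler_mean _ _ _ (fun n =>
  norm_sqr_normcB_le _ _ (P n) M _ e20 (hM n))) _.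
rewrite -/C.
have -> : (fun n => e / 2 + C * ComplexField.Normc.normc (h n - P n) ^+ 2) =
          (fun n => C * ComplexField.Normc.normc (h n - P n) ^+ 2 + e / 2).
  by apply/funext => n; rewrite addrC.
rewrite (mean_linear _ _ _ (fun=> e / 2)) mean_cst// -lerBrDr.
have -> : e - e / 2 = C * (e / 2 / C) by field; rewrite gt_eqF.
by rewrite ler_pM2l.
Qed.

(* For fixed [N] the average over [m] moves the shifts of [|g - Q|] back to its
   plain averages, by asymptotic invariance of [Phi K] under the finitely many
   elements of [Phi N]. *)
Lemma mean_mean_shift (R : realType) (Phi : nat -> {fset nat})
    (g : nat -> R) (B : R) : folner R Phi -> (forall n, `|g n| <= B) ->
  (forall e, 0 < e -> exists2 Q, trigfun R Q &
    \forall N \near \oo, mean (Phi N) (fun n => `|g n - Q n|) <= e) ->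
  forall e, 0 < e -> \forall N \near \oo, \forall K \near \oo,
    mean (Phi K) (fun m =>
      `|mean (Phi N) (fun n => g (n + m)%N) - mean (Phi N) g|) <= e.
Proof.
move=> PhiF gB gQ e e0.
(* Four errors of e / 4: the shift of Q over [Phi N], the means of d over [Phi N] and over [Phi K],
   and the boundary of [Phi K]. *)
have e40 : 0 < e / 4 by rewrite divr_gt0.
have [Q tQ nQ] := gQ _ e40.
have [D QD] := trigfun_bounded _ tQ.
pose d n := `|g n - Q n|.
have dD n : `|d n| <= B + D.
  by rewrite normr_id; apply: le_trans (ler_normB _ _) _; rewrite lerD.
near=> N.
have QN : forall m, `|mean (Phi N) (fun n => Q (n + m)%N) - mean (Phi N) Q|
    <= e / 4 by near: N; exact: trigfun_mean_shift.
have dN : mean (Phi N) d <= e / 4 by near: N.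
have Phi0 := PhiF.1.
have KN : \forall K \near \oo, forall n, n \in Phi N ->
    (B + D) * boundary_ratio R (Phi K) n <= e / 4.
  suff : \oo (\bigcap_(n in [set` Phi N])
      [set K | (B + D) * boundary_ratio R (Phi K) n <= e / 4]).
    by apply: filterS => K KN n; exact: KN.
  apply: filter_bigI => n _; have /cvgrPdist_lt := PhiF.2 n.
  have BD0 : 0 < B + D + 1.
    by rewrite ltr_wpDl//; apply: le_trans (dD 0%N).
  move=> /(_ (e / 4 / (B + D + 1))); rewrite divr_gt0// => /(_ isT).
  apply: filterS => K; rewrite sub0r normrN -/(boundary_ratio R (Phi K) n) => bK /=.
  have b0 : 0 <= boundary_ratio R (Phi K) n by rewrite divr_ge0.
  move: bK; rewrite ger0_norm// ltr_pdivlMr// => /ltW; apply: le_trans.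
  by rewrite mulrC ler_wpM2l// lerDl.
near=> K.
have dK : mean (Phi K) d <= e / 4 by near: K.
have step m : `|mean (Phi N) (fun n => g (n + m)%N) - mean (Phi N) g| <=
    mean (Phi N) (fun n => d (n + m)%N) + e / 2.
  have -> : mean (Phi N) (fun n => g (n + m)%N) - mean (Phi N) g =
    mean (Phi N) (fun n => g (n + m)%N - Q (n + m)%N) +
    (mean (Phi N) (fun n => Q (n + m)%N) - mean (Phi N) Q) -
    mean (Phi N) (fun n => g n - Q n) by rewrite !meanB; ring.
  apply: le_trans (ler_normB _ _) _.
  have -> : e / 2 = e / 4 + e / 4 by field.
  rewrite [leRHS]addrA; apply: lerD; last exact: le_trans (ler_norm_mean _ _) dN.
  by apply: le_trans (ler_normD _ _) _; rewrite lerD// ler_norm_mean.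
apply: le_trans (ler_mean _ _ _ step) _.
have -> : (fun m => mean (Phi N) (fun n => d (n + m)%N) + e / 2) =
  (fun m => 1 * mean (Phi N) (fun n => d (n + m)%N) + e / 2).
  by apply/funext => m; rewrite mul1r.
rewrite (mean_linear _ _ _ (fun=> e / 2)) mean_cst// mul1r.
(* After the exchange, each n in [Phi N] contributes the mean over [Phi K] of d shifted by n, to
   which [mean_shift] applies. *)
rewrite exchange_mean -lerBrDr.
have -> : e - e / 2 = e / 2 by field.
rewrite -[leRHS](mean_cst (Phi N))// /mean ler_wpM2r ?invr_ge0//.
rewrite big_seq [leRHS]big_seq; apply: ler_sum => n nN.
have /= := mean_shift (Phi K) d (B + D) n dD.
have KNn : (B + D) * boundary_ratio R (Phi K) n <= e / 4.
  by move: n nN; near: K.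
move=> /le_trans /(_ KNn); rewrite ler_norml => /andP[_].
under [X in mean _ X - _]eq_fun do rewrite addnC.
rewrite -/(mean (Phi K) (fun m => d (n + m)%N)); lra.
Unshelve. all: by end_near. Qed.

(** * Comparison of upper limits *)

Lemma limn_esup_le_near (R : realType) (u v : nat -> R) :
  (forall e, 0 < e -> \forall n \near \oo, u n <= v n + e) ->
  (limn_esup (fun n => (u n)%:E) <= limn_esup (fun n => (v n)%:E))%E.
Proof.
move=> uv; apply/lee_addgt0Pr => e e0; rewrite -leeBlDr//.
apply: le_ereal_inf_tmp => _ [A Aoo <-]; rewrite leeBlDr//.
(* Every tail set A competing in the upper limit of v is cut down to where the inequality holds, and
   the result competes in that of u. *)
apply: (@le_trans _ _ (ereal_sup [set (u n)%:E |
    n in A `&` [set n | u n <= v n + e]])).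
  by apply: ereal_inf_lbound; eexists => //; exact: filterI (uv _ e0).
apply: ge_ereal_sup => _ [n [An un] <-].
apply: (@le_trans _ _ ((v n)%:E + e%:E)%E); first by rewrite -EFinD lee_fin.
by rewrite leeD2r//; apply: ereal_sup_ubound; exists n.
Qed.

Lemma limn_esup_eq (R : realType) (u v : nat -> R) :
  (fun n => u n - v n) @ \oo --> (0 : R) ->
  limn_esup (fun n => (u n)%:E) = limn_esup (fun n => (v n)%:E).
Proof.
move=> uv; apply/eqP; rewrite eq_le; apply/andP; split;
  apply: limn_esup_le_near => e e0; move/cvgrPdist_lt: uv => /(_ _ e0);
  apply: filterS => n; rewrite sub0r normrN ltr_norml => /andP[]; lra.
Qed.

(** * Continuous extension of bounded sequences to the space of ultrafilters *)

Section BetaExtension.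
Context {R : realType}.
Implicit Types (p : betaN) (u : nat -> R).

(** The Stone-Čech extension of a bounded u; where no limit exists, [lim] returns a default
    value. *)
Definition betaext u (p : betaN) : R := lim (u @ uf p).

(** Compactness of [-M, M] gives a cluster point, and an ultrafilter converges to each of its
    cluster points. *)
Lemma uf_bounded_cvg p u (M : R) : (forall n, `|u n| <= M) -> cvg (u @ uf p).
Proof.
move=> uM; have FU := uf_ultra p.
have uI : (u @ uf p) `[- M, M]%classic.
  by apply: (@filterE _ (uf p)) => n; rewrite /= in_itv/= -ler_norml.
have [x [_ xu]] := @segment_compact R (- M) M (u @ uf p) _ uI.
apply/cvg_ex; exists x => B xB.
have [//|nB] := in_ultra_setVsetC (u @^-1` B) FU.
by have [y []] := xu (~` B) B nB xB.
Qed.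

Lemma betaext_cvg p u (M : R) : (forall n, `|u n| <= M) ->
  u @ uf p --> betaext u p.
Proof. by move=> /uf_bounded_cvg; exact. Qed.

Lemma uf_cvg_lim p u (l : R) : u @ uf p --> l -> betaext u p = l.
Proof. by have FU := uf_ultra p; exact: cvg_lim. Qed.

Lemma betaext_principal u m : betaext u (principal m) = u m.
Proof. by apply: uf_cvg_lim => B uB _ ->; exact: (nbhs_singleton uB). Qed.

Lemma betaext_ge0 u (M : R) : (forall n, 0 <= u n) -> (forall n, `|u n| <= M) ->
  forall p, 0 <= betaext u p.
Proof.
move=> u0 uM p; have FU := uf_ultra p.
rewrite /betaext; apply: limr_ge; first exact: (uf_bounded_cvg _ _ _ uM).
by apply: (@filterE _ (uf p)) => n; exact: u0.
Qed.

(** The ultrafilters containing the set where u is e-close to its limit along p form a basic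
    neighbourhood of p, and limits along them stay within e. *)
Lemma betaext_continuous u (M : R) : (forall n, `|u n| <= M) ->
  continuous (betaext u).
Proof.
move=> uM p; apply/(@cvgrPdist_le _ _ _ _ (nbhs_filter p)) => e e0.
have FP := uf_ultra p.
have /cvgrPdist_lt/(_ _ e0) pA := betaext_cvg p _ _ uM.
rewrite nbhsE; exists (betaN_base [set n | `|betaext u p - u n| < e]).
  split=> //; exists [set [set n | `|betaext u p - u n| < e]] => //.
  by rewrite bigcup_set1.
move=> q qA; have FU := uf_ultra q.
have uq := betaext_cvg q _ _ uM.
have dq : (fun n => `|betaext u p - u n|) @ uf q --> `|betaext u p - betaext u q|.
  by apply: cvg_norm; apply: cvgB => //; exact: cvg_cst.
rewrite /= -(cvg_lim _ dq)//; apply: limr_le.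
  by apply/cvg_ex; eexists; exact: dq.
by apply: filterS qA => n /ltW.
Qed.

End BetaExtension.

(** * Borel measurability and almost everywhere convergence *)

Lemma continuous_measurable_betaB (R : realType) (f : betaN -> R) :
  continuous f -> measurable_fun [set: betaB] (f : betaB -> R).
Proof.
move=> /continuousP cf; apply: (measurability _ (RGenOpens.measurableE R)).
move=> _ [_ [a [b ->] <-]]; rewrite setTI.
by apply: sub_sigma_algebra; exact/cf/interval_open.
Qed.

(** A Borel-Cantelli argument: summing under the integral, the series has integral at most c, so it
    is finite almost everywhere and its terms vanish in the limit. *)
Lemma ae_cvg0_summable_integral (d : measure_display)
    (T : measurableType d) (R : realType)
    (mu : {measure set T -> \bar R}) (f : nat -> T -> R) (c : R) :
  (forall k, measurable_fun setT (f k)) -> (forall k x, 0 <= f k x) ->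
  (forall k, \int[mu]_x (f k x)%:E <= (c / (2 ^ k.+1)%:R)%:E)%E -> 0 <= c ->
  {ae mu, forall x, f ^~ x @ \oo --> (0 : R)}.
Proof.
move=> mf f0 fc c0.
have mEf k : measurable_fun setT (fun x => (f k x)%:E) by exact/measurable_EFinP.
have f0E k x : (0 <= (f k x)%:E)%E by rewrite lee_fin.
have intf : mu.-integrable setT (fun x => \sum_(k <oo) (f k x)%:E)%E.
  apply/integrableP; split; first exact: ge0_emeasurable_sum.
  under eq_integral do rewrite gee0_abs ?nneseries_ge0//.
  rewrite integral_nneseries//.
  apply: (@le_lt_trans _ _ c%:E); last exact: ltry.
  apply: le_trans (epsilon_trick0 xpredT c0).
  by apply: lee_nneseries => // i _ _; exact: integral_ge0.
have := integrable_ae measurableT intf; apply: filterS => x /(_ I).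
rewrite ge0_fin_numE ?nneseries_ge0// => foo.
have := nneseries_tail_cvg foo (fun k _ => f0E k x).
move=> tail0.
suff : (fun k => (f k x)%:E) @ \oo --> (0%:E : \bar R) by case/fine_cvgP.
(* Each term lies between 0 and the tail of the series that starts with it. *)
apply: (@squeeze_cvge _ _ _ _ (fun=> 0%E) _ _ _ _ (cvg_cst _) tail0).
by apply: nearW => k; rewrite f0E/= (nneseries_split k 1)// addn1 big_nat1
  leeDl// nneseries_ge0.
Qed.

(** * Complex limits along an ultrafilter *)

Lemma normc_le_ReIm (R : realType) (z : R[i]) :
  ComplexField.Normc.normc z <= `|complex.Re z| + `|complex.Im z|.
Proof.
rewrite -ler_sqr ?nnegrE ?addr_ge0 ?normc_ge0// sqr_normcE sqrrD
  !real_normK ?num_real//.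
by rewrite addrAC lerDl mulrn_wge0// mulr_ge0.
Qed.

Lemma normc_ge_ReIm (R : realType) (z : R[i]) :
  `|complex.Re z| <= ComplexField.Normc.normc z /\
  `|complex.Im z| <= ComplexField.Normc.normc z.
Proof.
by split; rewrite -ler_sqr ?nnegrE ?normc_ge0// sqr_normcE real_normK ?num_real//
  ?lerDl ?lerDr sqr_ge0.
Qed.

Lemma ulim_to_sqr_normc (R : realType) (p : betaN) (u : nat -> R[i]) (z : R[i]) :
  ulim_to p u z ->
  (fun m => ComplexField.Normc.normc (u m) ^+ 2) @ uf p -->
    ComplexField.Normc.normc z ^+ 2.
Proof.
move=> uz; have FU := uf_ultra p.
have nu : (fun m => ComplexField.Normc.normc (u m)) @ uf p -->
    ComplexField.Normc.normc z.
  apply/cvgrPdist_lt => e e0; apply: filterS (uz _ e0) => m /=.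
  by rewrite distrC; apply: le_lt_trans (norm_normcB _ _ _).
under eq_fun do rewrite expr2.
by rewrite expr2; exact: cvgM.
Qed.

Lemma bounded_ulim_to (R : realType) (p : betaN) (u : nat -> R[i]) :
  bounded_cseq u -> exists z, ulim_to p u z.
Proof.
move=> [M uM]; have FU := uf_ultra p.
have ReM n : `|complex.Re (u n)| <= M.
  exact: le_trans (normc_ge_ReIm _ _).1 (uM n).
have ImM n : `|complex.Im (u n)| <= M.
  exact: le_trans (normc_ge_ReIm _ _).2 (uM n).
have /cvgrPdist_lt cRe := betaext_cvg p _ _ ReM.
have /cvgrPdist_lt cIm := betaext_cvg p _ _ ImM.
exists ((betaext (fun n => complex.Re (u n)) p) +i*
        (betaext (fun n => complex.Im (u n)) p))%C => e e0.
have e20 : 0 < e / 2 by rewrite divr_gt0.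
apply: filterS (filterI (cRe _ e20) (cIm _ e20)) => m /= [Rem Imm].
apply: le_lt_trans (normc_le_ReIm _ _) _; rewrite (splitr e).
by case: (u m) Rem Imm => a b /= Rem Imm; rewrite ltrD// distrC.
Qed.

(** Boundedness provides a limit, so the value chosen by [xget] in [Rp] is a genuine one and not the
    default 0. *)
Lemma Rp_sqr_normc_cvg (R : realType) (p : betaN) (h : nat -> R[i]) (n : nat) :
  bounded_cseq h ->
  (fun m => ComplexField.Normc.normc (h (n + m)%N) ^+ 2) @ uf p -->
    ComplexField.Normc.normc (Rp p h n) ^+ 2.
Proof.
move=> [M hM]; apply: ulim_to_sqr_normc; apply: xgetPex.
by apply: bounded_ulim_to; exists M => m; exact: hM.
Qed.

Lemma mean_cvg (R : realType) (A : {fset nat}) (p : betaN)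
    (f : nat -> nat -> R) (l : nat -> R) :
  (forall n, f n @ uf p --> l n) ->
  (fun m => mean A (f ^~ m)) @ uf p --> mean A l.
Proof.
move=> fl; have FU := uf_ultra p.
apply: cvgM; last exact: cvg_cst.
by apply: cvg_big => [|n _]; [exact: add_continuous | exact: fl].
Qed.

(** * Choice of the subsequence and the almost everywhere equality *)

Lemma strict_subseq_ge (N0 : nat -> nat) : exists sigma : nat -> nat,
  (forall n, (sigma n < sigma n.+1)%N) /\ forall n, (N0 n <= sigma n)%N.
Proof.
(* Partial sums of N0 i + 1 increase strictly and dominate their last term. *)
exists (fun n => \sum_(i < n.+1) (N0 i).+1)%N; split => n.
  by rewrite [ltnRHS]big_ord_recr/= addnS ltnS leq_addr.
by rewrite big_ord_recr/= addnS ltnW// ltnS leq_addl.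
Qed.

Lemma leq_strict_subseq (sigma : nat -> nat) :
  (forall n, (sigma n < sigma n.+1)%N) -> forall n, (n <= sigma n)%N.
Proof. by move=> inc; elim=> // n IH; exact: leq_ltn_trans (inc n). Qed.

Theorem theorem4p15 (R : realType) (Phi : nat -> {fset nat}) (h : nat -> R[i]) :
  folner R Phi -> besicovitch Phi h -> bounded_cseq h ->
  exists sigma : nat -> nat,
    (forall n, (sigma n < sigma n.+1)%N) /\
    forall mu : probability betaB R, accM (Phi \o sigma) mu ->
      exists S : set betaB,
        [/\ measurable S, mu S = 1%E &
            S `<=` [set p | besnorm (Phi \o sigma) (Rp p h)
                            = besnorm (Phi \o sigma) h]].
Proof.
move=> PhiF hB hbd; have [M hM] := hbd.
pose g n := ComplexField.Normc.normc (h n) ^+ 2.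
have gB n : `|g n| <= M ^+ 2.
  have M0 : 0 <= M := le_trans (normc_ge0 _ _) (hM n).
  by rewrite ger0_norm ?sqr_ge0// ler_sqr ?nnegrE ?normc_ge0.
pose D N m := `|mean (Phi N) (fun n => g (n + m)%N) - mean (Phi N) g|.
have DB N m : `|D N m| <= M ^+ 2 + M ^+ 2.
  have Phi0 := PhiF.1 N.
  by rewrite normr_id; apply: le_trans (ler_normB _ _) _;
    rewrite lerD// norm_mean_le.
(* One [eps k] bounds the means of D and another pays for the weak-* approximation; together they
   give the summable 2 ^ -k. *)
pose eps (k : nat) : R := 1 / (2 ^ k.+1)%:R.
have eps0 k : 0 < eps k by rewrite divr_gt0// ltr0n expn_gt0.
have epsD k : eps k + eps k = 2 / (2 ^ k.+1)%:R by rewrite /eps -mulrDl.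
have small k : exists N0, forall N, (N0 <= N)%N ->
    \forall K \near \oo, mean (Phi K) (D N) <= eps k.
  have [|N0 _ N0P] := mean_mean_shift R Phi g _ PhiF gB _ (eps k) (eps0 k).
    by move=> e e0; exact: besicovitch_sqr_normc.
  by exists N0.
have [N0 N0P] := choice small.
have [sigma [sigma_inc sigmaN0]] := strict_subseq_ge N0.
exists sigma; split=> // mu [_ muacc].
pose F k := betaext (D (sigma k)).
have cF k : continuous (F k) := betaext_continuous _ _ (DB (sigma k)).
have F0 k p : 0 <= F k p := betaext_ge0 _ _ (fun=> normr_ge0 _) (DB _) p.
have mF k : measurable_fun setT (F k : betaB -> R).
  exact: continuous_measurable_betaB.
have intF k : (\int[mu]_x (F k x)%:E <= (2 / (2 ^ k.+1)%:R)%:E)%E.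
  have [K1 _ K1P] := N0P k (sigma k) (sigmaN0 k).
  (* Test the accumulation property on the single continuous function [F k], at an index beyond
     K1. *)
  have [N NK1] := muacc 1%N (fun=> F k) (fun _ _ => cF k) _ (eps0 k) K1.
  move=> /(_ 0%N isT).
  have -> : avg (Phi \o sigma) (fun n => F k (principal n)) N =
            mean (Phi (sigma N)) (D (sigma k)).
    by congr mean; apply/funext => n; rewrite /F betaext_principal.
  have : mean (Phi (sigma N)) (D (sigma k)) <= eps k.
    (* The threshold K1 concerns [Phi] itself; it is passed along the subsequence because N <= sigma
       N. *)
    apply: K1P; apply: leq_trans NK1 _; exact: leq_strict_subseq.
  move: (mean _ _) => a aeps.
  case: (\int[mu]_x _)%E => [r| |]//.
  rewrite -EFinB abse_EFin lte_fin lee_fin -epsD ltr_norml => /andP[_].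
  by rewrite ltrBlDr => /ltW/le_trans; apply; rewrite lerD2l.
have [Z [mZ Z0 ZP]] := ae_cvg0_summable_integral _ _ _ _ _ _ mF F0 intF (ler0n _ 2).
exists (~` Z); split.
- exact: measurableC.
- by rewrite probability_setC// Z0 sube0.
move=> p pZ /=.
have F_cvg0 : (F ^~ p) @ \oo --> (0 : R).
  by apply: contrapT => nF; apply: pZ; apply: ZP => /=; exact: nF.
pose g' n := ComplexField.Normc.normc (Rp p h n) ^+ 2.
(* The set [Phi (sigma k)] is finite, so the limit along p passes inside the mean and turns shifts
   of g into g'. *)
have FE k : F k p = `|mean (Phi (sigma k)) g' - mean (Phi (sigma k)) g|.
  apply: uf_cvg_lim; have FU := uf_ultra p; apply: cvg_norm; apply: cvgB.
    by apply: (mean_cvg _ _ _ (fun n m => g (n + m)%N)) => n;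
      exact: Rp_sqr_normc_cvg.
  exact: cvg_cst.
rewrite /besnorm.
(* The seminorm depends only on this upper limit, so both sides agree once the upper limits do. *)
suff -> : limn_esup (fun N => (avg (Phi \o sigma) g' N)%:E) =
          limn_esup (fun N => (avg (Phi \o sigma) g N)%:E) by [].
apply: limn_esup_eq; apply/norm_cvg0P.
by under eq_fun do rewrite /= -FE.
Qed.
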